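(* Let $a_0,a_1,b_0,b_1,b_2\in\mathbb R$ with $b_1\le b_2$ and $a_0\ne0$, $a_1\neq 0$, and let $p(x,y)=b(x)+a(x)y$, where $a(x)=a_0(x+a_1)$ and $b(x)=b_0(x+b_1)(x+b_2)$. Assume that $p$ maps $\mathbb R_+^2$ into $(0,\infty)$. Then the net $\left\{\frac{1}{p(m,n)}\right\}_{m,n\in\mathbb Z_+}$ is joint completely monotone if and only if $b_1\le a_1\le b_2$.
   Context: $\mathbb Z_+$ and $\mathbb R_+$ denote the nonnegative integers and the nonnegative reals. For a net $\{a_\alpha\}_{\alpha\in\mathbb Z_+^n}$ of reals and $j=1,\dots,n$, $\triangle_ja_\alpha=a_{\alpha+\varepsilon_j}-a_\alpha$, where $\varepsilon_j$ has $j$th entry $1$ and $0$ elsewhere; $\triangle^\beta=\prod_j\triangle_j^{\beta_j}$ and $|\beta|=\beta_1+\cdots+\beta_n$. The net is joint completely monotone if $(-1)^{|\beta|}\triangle^\beta a_\alpha\ge0$ for all $\alpha,\beta\in\mathbb Z_+^n$. *)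

(* Defs.v *)
From HB Require Import structures.
From mathcomp Require Import all_boot all_order all_algebra.
From mathcomp Require Import reals.
Set Implicit Arguments.
Unset Strict Implicit.
Unset Printing Implicit Defensive.
Import Order.TTheory GRing.Theory Num.Theory.
Local Open Scope ring_scope.

Section Nets.
Variables (R : realType) (n : nat).

Definition multiindex := {ffun 'I_n -> nat}.

Definition mabs (beta : multiindex) : nat := (\sum_(j < n) beta j)%N.

Definition munit (j : 'I_n) : multiindex := [ffun i => nat_of_bool (i == j)].

Definition net := multiindex -> R.

Definition fdiff (j : 'I_n) (a : net) : net :=
  fun alpha => a (alpha + munit j) - a alpha.

(* The product of the operators is their composition; they commute, so the
   order (increasing in j, outermost first) is immaterial. *)
Definition mfdiff (beta : multiindex) : net -> net :=
  \big[(fun F G : net -> net => F \o G)/id]_(j < n) iter (beta j) (fdiff j).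

Definition joint_completely_monotone (a : net) : Prop :=
  forall alpha beta : multiindex,
    0 <= (-1) ^+ mabs beta * mfdiff beta a alpha.

End Nets.

Section BivariatePolynomial.
Variable R : realType.

Definition lin_coef (a0 a1 x : R) : R := a0 * (x + a1).

Definition quad_coef (b0 b1 b2 x : R) : R := b0 * (x + b1) * (x + b2).

Definition bipoly (a0 a1 b0 b1 b2 x y : R) : R :=
  quad_coef b0 b1 b2 x + lin_coef a0 a1 x * y.

(* {f(m, n)}_{m, n} as a net on Z_+^2: m and n are the entries of the
   multi-index at positions 0 and 1. *)
Definition net2 (f : nat -> nat -> R) : net R 2 :=
  fun alpha => f (alpha ord0) (alpha ord_max).

End BivariatePolynomial.

(* Main.v *)
Require Import Defs.
From HB Require Import structures.
From mathcomp Require Import all_boot all_order all_algebra.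
From mathcomp Require Import reals boolp.
From mathcomp Require Import ring lra zify.
Set Implicit Arguments.
Unset Strict Implicit.
Unset Printing Implicit Defensive.
Import Order.TTheory GRing.Theory Num.Theory.
Local Open Scope ring_scope.

(** Positivity of [p] on the quadrant forces [a0], [a1], [b0], [b1], [b2] to be
    positive ([bipoly_pos_coefs]), so that [1 / p(m, n) = d m / (c m + n)] with
    [d m = 1 / a(m)] and [c m = b(m) / a(m)].  Everything is decided by the
    shape of [c].  With [k = b0 / a0],
      [c m = k * (m + b1 + b2 - a1) + k * (b1 - a1) * (b2 - a1) / (m + a1)],
    which is concave exactly when the last coefficient is nonpositive, that is,
    when [b1 <= a1 <= b2].

    If [b1 <= a1 <= b2], the increments of the net [c m + n] in both directions
    are completely monotone: a nonnegative constant plus a nonnegative multiple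
    of minus the increment of [1 / (m + a1)].  The reciprocal of a positive net
    with completely monotone increments is completely monotone ([cm_inv]), as
    the reciprocal of a Bernstein function is; multiplying by the completely
    monotone [d m] gives the net [1 / p] ([inv_bipoly_cm]).

    Conversely, differencing [l] times in the second direction shows that
    [d m * l! / ((c m + n) (c m + n + 1) ... (c m + n + l))] is a completely
    monotone sequence in [m], for all [n] and [l].  Such a sequence is log-convex
    ([cmseq_logconvex]).  Comparing its terms at [m = 0, 1, 2] bounds, uniformly
    in [n] and [l], the product over [n <= N <= n + l] of
    [(c 0 + N) (c 2 + N) / (c 1 + N)^2].  If [c 0 + c 2 > 2 * c 1], these factors
    exceed [1 + const / N] for large [N] and the product diverges like a power
    of [l] ([ratio_unbounded]).  Hence [c 0 + c 2 <= 2 * c 1]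
    ([joint_cm_midpoint_concave]), and the formula for [c] concludes. *)

(** * Completely monotone nets *)

Section CompleteMonotonicity.
Variables (R : realType) (n : nat).
Implicit Types (a f g h : net R n) (k : nat) (j : 'I_n).

Definition ndiff j a : net R n := fun alpha => a alpha - a (alpha + munit j).

(** Complete monotonicity truncated at order [k].  The truncation makes closure
    properties provable by induction on the order, without expanding mixed
    differences of products by a multinomial Leibniz formula. *)
Fixpoint cm_upto k a : Prop :=
  (forall alpha, 0 <= a alpha) /\
  if k is k'.+1 then forall j, cm_upto k' (ndiff j a) else True.

Definition cm a : Prop := forall k, cm_upto k a.

Lemma cm_upto_ge0 k a alpha : cm_upto k a -> 0 <= a alpha.
Proof. by case: k => [|k] [a_ge0 _]. Qed.

Lemma cm_uptoW k a : cm_upto k.+1 a -> cm_upto k a.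
Proof.
elim: k a => [|k IHk] a [a_ge0 acm]; split=> // j.
exact: IHk (acm j).
Qed.

Lemma cm_ndiff j a : cm a -> cm (ndiff j a).
Proof. by move=> acm k; have [_] := acm k.+1; apply. Qed.

Lemma cm_upto_shift k a mu :
  cm_upto k a -> cm_upto k (fun alpha => a (alpha + mu)).
Proof.
elim: k a => [|k IHk] a [a_ge0 acm]; split=> // j.
have -> : ndiff j (fun alpha => a (alpha + mu)) =
          (fun alpha => ndiff j a (alpha + mu)).
  by apply/funext => alpha; rewrite /ndiff addrAC.
exact: IHk (acm j).
Qed.

Lemma cm_upto_const k (c : R) : 0 <= c -> cm_upto k (fun=> c).
Proof.
elim: k c => [|k IHk] c c_ge0; split=> // j.
have -> : ndiff j (fun=> c) = (fun=> 0) by apply/funext => x; rewrite /ndiff subrr.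
exact: IHk.
Qed.

Lemma cm_upto_add k f g :
  cm_upto k f -> cm_upto k g -> cm_upto k (fun alpha => f alpha + g alpha).
Proof.
elim: k f g => [|k IHk] f g [f_ge0 fcm] [g_ge0 gcm];
  split=> [alpha|] //; rewrite ?addr_ge0// => j.
have -> : ndiff j (fun alpha => f alpha + g alpha) =
          (fun alpha => ndiff j f alpha + ndiff j g alpha).
  by apply/funext => alpha; rewrite /ndiff; ring.
exact: IHk (fcm j) (gcm j).
Qed.

(** Leibniz rule: minus the difference of [f * g] is a sum of products, in each of
    which only one factor has been differenced. *)
Lemma cm_upto_mul k f g :
  cm_upto k f -> cm_upto k g -> cm_upto k (fun alpha => f alpha * g alpha).
Proof.
elim: k f g => [|k IHk] f g fcm gcm; split=> [alpha|] //;
  rewrite ?mulr_ge0 ?(cm_upto_ge0 _ fcm) ?(cm_upto_ge0 _ gcm)// => j.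
have -> : ndiff j (fun alpha => f alpha * g alpha) =
          (fun alpha => ndiff j f alpha * g alpha
                        + f (alpha + munit j) * ndiff j g alpha).
  by apply/funext => alpha; rewrite /ndiff; ring.
apply: cm_upto_add; apply: IHk.
- by case: fcm => _; apply.
- exact: cm_uptoW.
- exact/cm_upto_shift/cm_uptoW.
- by case: gcm => _; apply.
Qed.

(** Since [1/h - 1/h' = (h' - h) * (1/h) * (1/h')], complete monotonicity of [1/h]
    at order [k.+1] follows from that of [1/h] and its shift at order [k]. *)
Lemma cm_inv h : (forall alpha, 0 < h alpha) -> (forall j, cm (fdiff j h)) ->
  cm (fun alpha => (h alpha)^-1).
Proof.
move=> h_gt0 dhcm; elim=> [|k IHk]; split=> [alpha|] //;
  rewrite ?invr_ge0 ?(ltW (h_gt0 _))// => j.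
have -> : ndiff j (fun alpha => (h alpha)^-1) =
    (fun alpha => fdiff j h alpha * ((h alpha)^-1 * (h (alpha + munit j))^-1)).
  apply/funext => alpha; rewrite /ndiff /fdiff; field.
  by rewrite !gt_eqF.
apply: cm_upto_mul; first exact: dhcm.
by apply: cm_upto_mul => //; apply: (cm_upto_shift _ IHk).
Qed.

Lemma addmunitE (alpha : multiindex n) i j :
  (alpha + munit j) i = (alpha i + (i == j))%N.
Proof. by rewrite !ffunE. Qed.

Lemma cm_inv_affine (c : R) (w : 'I_n -> R) : 0 < c -> (forall i, 0 <= w i) ->
  cm (fun alpha => (c + \sum_i w i * (alpha i)%:R)^-1).
Proof.
move=> c_gt0 w_ge0; apply: cm_inv => [alpha|j].
  by rewrite ltr_wpDr// sumr_ge0// => i _; rewrite mulr_ge0.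
have -> : fdiff j (fun alpha => c + \sum_i w i * (alpha i)%:R) = (fun=> w j).
  apply/funext => alpha; rewrite /fdiff.
  rewrite opprD addrACA subrr add0r -sumrB (bigD1 j)//= big1 => [|i ij].
    by rewrite addmunitE eqxx addn1 -natr1; ring.
  by rewrite addmunitE (negbTE ij) addn0; ring.
by move=> k; exact: cm_upto_const.
Qed.

Lemma iter_ndiffE j k a alpha :
  iter k (ndiff j) a alpha = (-1) ^+ k * iter k (fdiff j) a alpha.
Proof.
elim: k alpha => [|k IHk] alpha; first by rewrite mul1r.
by rewrite !iterS {1}/ndiff !IHk /fdiff exprS; ring.
Qed.

Lemma iter_fdiffZ j k (c : R) a :
  iter k (fdiff j) (fun alpha => c * a alpha) =
  (fun alpha => c * iter k (fdiff j) a alpha).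
Proof.
by elim: k => //= k ->; apply/funext => alpha; rewrite /fdiff mulrBr.
Qed.

(** Distributing the sign over the iterated operators turns the signed mixed
    differences into plain compositions of the operators [ndiff j]. *)
Lemma mfdiff_signE (beta : multiindex n) a :
  (fun alpha => (-1) ^+ mabs beta * mfdiff beta a alpha) =
  (\big[(fun F G : net R n -> net R n => F \o G)/id]_(j < n)
     iter (beta j) (ndiff j)) a.
Proof.
rewrite /mabs /mfdiff; elim: (index_enum _) => [|j r IHr].
  by apply/funext => alpha; rewrite !big_nil mul1r.
apply/funext => alpha; rewrite !big_cons /= -IHr iter_ndiffE iter_fdiffZ.
by rewrite exprD mulrA.
Qed.

Lemma cm_joint a : cm a -> joint_completely_monotone a.
Proof.
move=> acm alpha beta.
suff /(_ 0) : cm (fun alpha => (-1) ^+ mabs beta * mfdiff beta a alpha).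
  exact: cm_upto_ge0.
rewrite mfdiff_signE; elim/big_ind: _ (a) acm => //= [F G cF cG b /cG/cF//|j _ b].
by elim: (beta j) => //= k IHk /IHk; apply: cm_ndiff.
Qed.

End CompleteMonotonicity.

(** * Completely monotone sequences are log-convex *)

Section Sequences.
Variable R : realType.
Implicit Types u : nat -> R.

Definition sdiff u : nat -> R := fun m => u m - u m.+1.

Definition cmseq u := forall k m, 0 <= iter k sdiff u m.

Lemma cmseq_shift u : cmseq u -> cmseq (fun m => u m.+1).
Proof.
move=> ucm k m.
suff -> : iter k sdiff (fun m => u m.+1) m = iter k sdiff u m.+1 by [].
by elim: k m => //= k IHk m; rewrite /sdiff !IHk.
Qed.

Lemma cmseq_sdiff u : cmseq u -> cmseq (sdiff u).
Proof. by move=> ucm k m; rewrite -iterSr. Qed.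

(** This is positivity of the Bernstein polynomial of degree [N]: if the sequence
    is written formally as [u m = L(t^m)], the right-hand side is [L] of
    [sum_i (x + y i)^2 C(N, i) t^i (1 - t)^(N - i)
       = (x + y N t)^2 + y^2 N t (1 - t)].
    Under [L], the recursion [B_(N+1) f = (1 - t) B_N f + t B_N (f (1 + _))] for
    Bernstein operators reads as the induction step below: multiplying by
    [1 - t] is differencing [u], multiplying by [t] is shifting it, and
    [f (1 + _)] replaces [x] by [x + y]. *)
Lemma cmseq_bernstein u (x y : R) N : cmseq u ->
  0 <= x ^+ 2 * u 0%N + 2 * x * y * N%:R * u 1%N + y ^+ 2 * N%:R ^+ 2 * u 2%N
       + y ^+ 2 * N%:R * (u 1%N - u 2%N).
Proof.
elim: N u x => [|N IHN] u x ucm.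
  have := mulr_ge0 (sqr_ge0 x) (ucm 0 0)%N; rewrite /=; lra.
have := addr_ge0 (IHN _ x (cmseq_sdiff ucm)) (IHN _ (x + y) (cmseq_shift ucm)).
by congr (0 <= _); rewrite /sdiff -natr1; ring.
Qed.

Lemma ex_natr_gt (x : R) : exists N : nat, x < N%:R.
Proof.
exists (Num.bound `|x|); apply: le_lt_trans (ler_norm x) _.
exact/archi_boundP/normr_ge0.
Qed.

Lemma natr_scale_ge0 (x y : R) : (forall N, 0 <= N%:R * x + y) -> 0 <= x.
Proof.
move=> H; rewrite leNgt; apply/negP => x_lt0.
have [N HN] := ex_natr_gt (y / - x).
by have := H N; move: HN; rewrite ltr_pdivrMr ?oppr_gt0//; lra.
Qed.

(** The quadratic form [x^2 u 0 + 2 x y u 1 + y^2 u 2] is nonnegative, as the limit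
    of Bernstein sums; evaluate it at [x = u 1], [y = - u 0]. *)
Lemma cmseq_logconvex u : cmseq u -> 0 < u 0%N -> u 1%N ^+ 2 <= u 0%N * u 2%N.
Proof.
move=> ucm u0_gt0; rewrite -subr_ge0 -(pmulr_rge0 _ u0_gt0).
apply: (@natr_scale_ge0 _ (u 0%N ^+ 2 * (u 1%N - u 2%N))) => -[|N].
  have /= := ucm 1%N 1%N; rewrite /sdiff => H.
  by rewrite mul0r add0r mulr_ge0 ?sqr_ge0.
rewrite -(@pmulr_rge0 _ N.+1%:R) ?ltr0Sn//.
have := cmseq_bernstein (N.+1%:R * u 1%N) (- u 0%N) N.+1 ucm.
by congr (0 <= _); ring.
Qed.

(** * Differences of reciprocals and divergent products *)

Lemma rising_shift (x : R) l :
  \prod_(i < l.+1) (x + i%:R) = x * \prod_(i < l) (x + 1 + i%:R).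
Proof.
rewrite big_ord_recl addr0; congr (_ * _); apply: eq_bigr => i _.
by rewrite /= /bump /= natrD addrA.
Qed.

Lemma iter_sdiff_inv (d x : R) l m : 0 < x ->
  iter l sdiff (fun i => d * (x + i%:R)^-1) m =
  d * l`!%:R * (\prod_(i < l.+1) (x + m%:R + i%:R))^-1.
Proof.
move=> x_gt0; elim: l m => [|l IHl] m.
  by rewrite big_ord1 addr0 mulr1.
rewrite iterS {1}/sdiff !IHl.
have -> : x + m.+1%:R = x + m%:R + 1 by rewrite -natr1 addrA.
set z := x + m%:R; have z_gt0 : 0 < z by rewrite ltr_wpDr.
rewrite [\prod_(i < l.+2) _]rising_shift [\prod_(i < l.+1) (z + _)]rising_shift.
rewrite [\prod_(i < l.+1) _]big_ord_recr /=.
set P := \prod_(i < l) _.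
have P_gt0 : 0 < P by apply: prodr_gt0 => i _; rewrite ltr_wpDr// ltr_wpDr.
have zl_gt0 : 0 < z + 1 + l%:R by rewrite ltr_wpDr// ltr_wpDr.
rewrite factS natrM -natr1; field.
by rewrite !gt_eqF.
Qed.

(** A power of the product telescopes: for an integer [K >= 1 / e], each factor
    satisfies [r i ^ K >= 1 + 1 / (n + i + 1) = (n + i + 2) / (n + i + 1)]. *)
Lemma prod_unbounded (r : nat -> R) (e : R) n : 0 < e ->
  (forall i, 1 + e / (n + i).+1%:R <= r i) ->
  forall B, exists l, B < \prod_(i < l.+1) r i.
Proof.
move=> e_gt0 r_ge B.
have [K HK] : exists K : nat, 1 <= K%:R * e.
  have [K HK] := ex_natr_gt e^-1.
  by exists K; rewrite -ler_pdivrMr// mul1r ltW.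
have r_gt0 i : 0 < r i.
  by apply: lt_le_trans (r_ge i); rewrite ltr_pwDl// divr_ge0// ltW.
have rK i : (n + i).+2%:R <= (n + i).+1%:R * r i ^+ K.
  have Bernoulli k (y : R) : 0 <= y -> 1 + k%:R * y <= (1 + y) ^+ k.
    move=> y_ge0; elim: k => [|k IHk]; first by rewrite mul0r addr0.
    rewrite exprS; apply: le_trans (ler_wpM2l _ IHk); last by rewrite addr_ge0.
    have := mulr_ge0 (ler0n R k) (sqr_ge0 y); rewrite -natr1; lra.
  set M : R := (n + i).+1%:R; have M_gt0 : 0 < M by rewrite ltr0Sn.
  have -> : (n + i).+2%:R = M * (1 + M^-1).
    by rewrite mulrDr mulfV ?gt_eqF// mulr1 natr1.
  rewrite ler_pM2l//; apply: (@le_trans _ _ ((1 + e / M) ^+ K)).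
    apply: le_trans (Bernoulli K _ _); last by rewrite divr_ge0// ltW.
    by rewrite lerD2l mulrA ler_pdivlMr// mulVf ?gt_eqF.
  by rewrite lerXn2r// ?nnegrE ?r_ge// ltW// ltr_pwDl// divr_ge0// ltW.
have prodK l : (n + l).+1%:R <= n.+1%:R * (\prod_(i < l) r i) ^+ K.
  elim: l => [|l IHl]; first by rewrite addn0 big_ord0 expr1n mulr1.
  rewrite big_ord_recr /= exprMn mulrA addnS; apply: le_trans (rK l) _.
  by rewrite ler_wpM2r// exprn_ge0// ltW.
apply: contrapT => no_l.
have prod_le l : \prod_(i < l.+1) r i <= B.
  by rewrite leNgt; apply/negP => Bl; apply: no_l; exists l.
pose C := n.+1%:R * B ^+ K.
have [l] := ex_natr_gt C.
apply/negP; rewrite -leNgt.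
apply: (@le_trans _ _ (n + l.+1).+1%:R); first by rewrite ler_nat; lia.
apply: le_trans (prodK l.+1) _.
have P_ge0 : 0 <= \prod_(i < l.+1) r i by apply: prodr_ge0 => i _; exact: ltW.
rewrite ler_pM2l ?ltr0Sn// lerXn2r// nnegrE//.
exact: le_trans (prod_le l).
Qed.

(** With [x = n + i] and [e = c0 + c2 - 2 * c1], a factor minus one equals
    [(e x + c0 c2 - c1^2) / (c1 + x)^2], which for [x >= c1] and
    [e x >= 2 c1^2] is at least [(e x / 2) / (2 x)^2 = e / (8 x)]. *)
Lemma ratio_unbounded (c0 c1 c2 : R) : 0 < c0 -> 0 < c1 -> 0 < c2 ->
  2 * c1 < c0 + c2 ->
  forall B, exists n l, B < \prod_(i < l.+1)
    ((c0 + n%:R + i%:R) * (c2 + n%:R + i%:R) / (c1 + n%:R + i%:R) ^+ 2).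
Proof.
move=> c0_gt0 c1_gt0 c2_gt0 c1_lt B.
pose e := c0 + c2 - 2 * c1; have e_gt0 : 0 < e by rewrite subr_gt0.
have [n] := ex_natr_gt (Num.max c1 (2 * c1 ^+ 2 / e)).
rewrite gt_max ltr_pdivrMr// => /andP[/ltW c1n /ltW].
rewrite [_ * e]mulrC => qn.
have [|i|l Hl] := @prod_unbounded (fun i : nat => (c0 + n%:R + i%:R) *
    (c2 + n%:R + i%:R) / (c1 + n%:R + i%:R) ^+ 2) (e / 8) n _ _ B.
- by rewrite divr_gt0.
- rewrite -!addrA -natrD -[(n + i).+1%:R]natr1; set x : R := (n + i)%:R.
  have xn : n%:R <= x by rewrite ler_nat leq_addr.
  (* [field] would otherwise look through [x] and ask for [n%:R + i%:R != 0]. *)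
  clearbody x.
  have x_ge : c1 <= x := le_trans c1n xn.
  have x_q : 2 * c1 ^+ 2 <= e * x by apply: le_trans qn _; rewrite ler_pM2l.
  have x_gt0 : 0 < x := lt_le_trans c1_gt0 x_ge.
  apply: (@le_trans _ _ (1 + e / 8 / x)).
    rewrite lerD2l ler_wpM2l ?divr_ge0 ?(ltW e_gt0)// lef_pV2 ?posrE ?lerDl//.
    by rewrite addr_gt0.
  rewrite ler_pdivlMr ?exprn_gt0 ?addr_gt0// -(ler_pM2l x_gt0).
  have -> : x * ((1 + e / 8 / x) * (c1 + x) ^+ 2) = (x + e / 8) * (c1 + x) ^+ 2.
    by field; rewrite gt_eqF.
  have d : (c1 + x) ^+ 2 <= 4 * x ^+ 2.
    have -> : 4 * x ^+ 2 = (x + x) ^+ 2 by ring.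
    by rewrite lerXn2r ?nnegrE ?lerD2r// ltW// addr_gt0.
  have := ler_wpM2l (ltW e_gt0) d.
  have := ler_wpM2l (ltW x_gt0) x_q.
  have := mulr_gt0 x_gt0 (mulr_gt0 c0_gt0 c2_gt0).
  have -> : c0 = e + 2 * c1 - c2 by rewrite /e; ring.
  by lra.
by exists n, l.
Qed.

End Sequences.

(** * Bivariate nets *)

Section Bivariate.
Variable R : realType.
Implicit Types f : nat -> nat -> R.

Lemma ndiff_net2_l f :
  ndiff ord0 (net2 f) = net2 (fun m n => f m n - f m.+1 n).
Proof.
by apply/funext => alpha; rewrite /ndiff /net2 !addmunitE /= addn0 addn1.
Qed.

Lemma ndiff_net2_r f : ndiff ord_max (net2 f) = net2 (fun m => sdiff (f m)).
Proof.
by apply/funext => alpha; rewrite /ndiff /net2 !addmunitE /= addn0 addn1.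
Qed.

(** Mixed differences factor: freezing the second coordinate after differencing
    [l] times along it leaves a completely monotone sequence in the first. *)
Lemma joint_cmseq f l n : joint_completely_monotone (net2 f) ->
  cmseq (fun m => iter l (@sdiff R) (f m) n).
Proof.
move=> fcm k m.
have := fcm [ffun i => if i == ord0 then m else n]
            [ffun i => if i == ord0 then k else l].
rewrite -[_ * _]/((fun alpha => _ * mfdiff _ (net2 f) alpha) _) mfdiff_signE.
rewrite !big_ord_recl big_ord0 /= !ffunE /=.
have -> : lift ord0 (ord0 : 'I_1) = ord_max :> 'I_2 by apply/val_inj.
have -> : iter l (ndiff ord_max) (net2 f) = net2 (fun m => iter l (@sdiff R) (f m)).
  by elim: l => //= l ->; rewrite ndiff_net2_r.
set g := fun m => iter l _ (f m).
have -> : iter k (ndiff ord0) (net2 g) =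
          net2 (fun m n => iter k (@sdiff R) (fun i => g i n) m).
  by elim: k => //= k ->; rewrite ndiff_net2_l.
by rewrite /net2 !ffunE.
Qed.

(** Log-convexity in [m] of the [l]-th differences bounds the product of
    [ratio_unbounded] by [d 0 * d 2 / d 1 ^+ 2] for all [n] and [l]. *)
Lemma joint_cm_midpoint_concave (d c : nat -> R) :
  (forall m, 0 < d m) -> (forall m, 0 < c m) ->
  joint_completely_monotone (net2 (fun m n => d m * (c m + n%:R)^-1)) ->
  c 0%N + c 2%N <= 2 * c 1%N.
Proof.
move=> d_gt0 c_gt0 jcm; rewrite leNgt; apply/negP => c_cvx.
have [n [l]] := ratio_unbounded (c_gt0 _) (c_gt0 _) (c_gt0 _) c_cvx
                  (d 0%N * d 2%N / d 1%N ^+ 2).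
apply/negP; rewrite -leNgt.
have := @cmseq_logconvex _ _ (joint_cmseq l n jcm).
rewrite !iter_sdiff_inv//.
have -> : \prod_(i < l.+1) ((c 0%N + n%:R + i%:R) * (c 2%N + n%:R + i%:R) /
                            (c 1%N + n%:R + i%:R) ^+ 2) =
          \prod_(i < l.+1) (c 0%N + n%:R + i%:R) *
          \prod_(i < l.+1) (c 2%N + n%:R + i%:R) /
          (\prod_(i < l.+1) (c 1%N + n%:R + i%:R)) ^+ 2.
  by rewrite prodf_div big_split /= prodrXl.
have P_gt0 m : 0 < \prod_(i < l.+1) (c m + n%:R + i%:R).
  by apply: prodr_gt0 => i _; rewrite !ltr_wpDr.
move: (P_gt0 0%N) (P_gt0 1%N) (P_gt0 2%N).
set P0 := \prod_(i < _) (c 0%N + _ + _); set P1 := \prod_(i < _) (c 1%N + _ + _).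
set P2 := \prod_(i < _) (c 2%N + _ + _) => P0_gt0 P1_gt0 P2_gt0.
have F_gt0 : 0 < l`!%:R :> R by rewrite ltr0n fact_gt0.
have d0 := d_gt0 0%N; have d1 := d_gt0 1%N; have d2 := d_gt0 2%N.
move=> /(_ (mulr_gt0 (mulr_gt0 d0 F_gt0) _)); rewrite invr_gt0 => /(_ P0_gt0).
have -> : d 0%N * l`!%:R * P0^-1 * (d 2%N * l`!%:R * P2^-1) =
          (d 0%N * d 2%N / (P0 * P2)) * l`!%:R ^+ 2.
  by field; rewrite !gt_eqF.
have -> : (d 1%N * l`!%:R * P1^-1) ^+ 2 = (d 1%N ^+ 2 / P1 ^+ 2) * l`!%:R ^+ 2.
  by field; rewrite !gt_eqF.
rewrite ler_pM2r ?exprn_gt0// ler_pdivrMr ?exprn_gt0// mulrAC.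
rewrite ler_pdivlMr ?mulr_gt0// => H.
by rewrite ler_pdivrMr ?exprn_gt0// mulrAC ler_pdivlMr ?exprn_gt0// mulrC.
Qed.

(** Letting [y] grow gives [a(x) >= 0], letting [x] grow gives the signs of the
    leading coefficients, and a root [- b1 >= 0] of [b] is excluded by [y = 0]. *)
Lemma bipoly_pos_coefs (a0 a1 b0 b1 b2 : R) : b1 <= b2 -> a0 != 0 -> a1 != 0 ->
  (forall x y, 0 <= x -> 0 <= y -> 0 < bipoly a0 a1 b0 b1 b2 x y) ->
  [/\ 0 < a0, 0 < a1, 0 < b0 & 0 < b1].
Proof.
move=> b12 a0_neq0 a1_neq0 p_gt0.
have b_gt0 x : 0 <= x -> 0 < b0 * (x + b1) * (x + b2).
  by move=> x_ge0; have := p_gt0 x 0 x_ge0 (lexx _); rewrite /bipoly mulr0 addr0.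
have a_ge0 x : 0 <= x -> 0 <= a0 * (x + a1).
  move=> x_ge0; apply: (@natr_scale_ge0 _ _ (b0 * (x + b1) * (x + b2))) => N.
  by have /ltW := p_gt0 x N%:R x_ge0 (ler0n _ _); rewrite /bipoly addrC mulrC.
have absD (x : R) : 0 <= `|x| + x by have := ler_norm (- x); rewrite normrN; lra.
have a0_gt0 : 0 < a0.
  rewrite lt0r a0_neq0 -(@pmulr_lge0 _ (1 + `|a1| + a1)); last first.
    by rewrite -addrA ltr_pwDl.
  by rewrite a_ge0// addr_ge0.
split=> //.
- by rewrite lt0r a1_neq0 -(pmulr_rge0 _ a0_gt0) -[a1]add0r a_ge0.
- have := b_gt0 (`|b1| + `|b2|) (addr_ge0 _ _); rewrite !normr_ge0 => /(_ isT isT).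
  rewrite -mulrA => H; rewrite ltNge; apply/negP => b0_le0.
  move: H; apply/negP; rewrite -leNgt mulr_le0_ge0// mulr_ge0//.
    by rewrite addrAC addr_ge0.
  by rewrite -addrA addr_ge0.
- rewrite ltNge; apply/negP => b1_le0.
  by have := b_gt0 (- b1); rewrite oppr_ge0 addNr mulr0 mul0r ltxx => /(_ b1_le0).
Qed.

(** The net [h] is [b(m) / a(m) + n], expanded in partial fractions; [g] is
    [1 / (m + a1)]. *)
Lemma inv_bipoly_cm (a0 a1 b0 b1 b2 : R) :
  0 < a0 -> 0 < a1 -> 0 < b0 -> 0 < b1 -> b1 <= a1 <= b2 ->
  cm (net2 (fun m n => 1 / bipoly a0 a1 b0 b1 b2 m%:R n%:R)).
Proof.
move=> a0_gt0 a1_gt0 b0_gt0 b1_gt0 /andP[ba ab].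
have b2_gt0 : 0 < b2 by apply: lt_le_trans ab.
pose k := b0 / a0; have k_gt0 : 0 < k by rewrite divr_gt0.
pose kappa := k * ((a1 - b1) * (b2 - a1)).
have kappa_ge0 : 0 <= kappa.
  by rewrite mulr_ge0 ?(ltW k_gt0)// mulr_ge0// subr_ge0.
pose g : net R 2 := fun alpha => ((alpha ord0)%:R + a1)^-1.
have g_cm : cm g.
  have := @cm_inv_affine R 2 a1 (fun i => (i == ord0)%:R) a1_gt0 (fun i => ler0n _ _).
  congr cm; apply/funext => alpha.
  by rewrite /g big_ord_recl big_ord1 /= mul1r mul0r addr0 addrC.
pose h : net R 2 := fun alpha =>
  k * ((alpha ord0)%:R + (b1 + b2 - a1)) + (alpha ord_max)%:R - kappa * g alpha.
have hE alpha : h alpha = (alpha ord_max)%:R +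
    k * ((alpha ord0)%:R + b1) * ((alpha ord0)%:R + b2) * g alpha.
  rewrite /h /kappa /g; have : 0 < (alpha ord0)%:R + a1 by rewrite ltr_wpDl.
  move: (alpha ord0)%:R => m m_gt0.
  by field; rewrite gt_eqF.
have g_gt0 alpha : 0 < g alpha by rewrite invr_gt0 ltr_wpDl.
have h_gt0 alpha : 0 < h alpha.
  rewrite hE ltr_wpDl// mulr_gt0//.
  by apply: mulr_gt0; first apply: mulr_gt0; rewrite ?ltr_wpDl.
have dh_cm j : cm (fdiff j h).
  have -> : fdiff j h = (fun alpha =>
      (k * (j == ord0)%:R + (j == ord_max)%:R) + kappa * ndiff j g alpha).
    apply/funext => alpha; rewrite /fdiff /h /ndiff !addmunitE !natrD.
    by rewrite ![_ == j]eq_sym; ring.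
  move=> l; apply: cm_upto_add; last apply: cm_upto_mul.
  - by apply: cm_upto_const; rewrite addr_ge0// mulr_ge0// ltW.
  - exact: cm_upto_const.
  - exact: cm_ndiff.
have -> : net2 (fun m n => 1 / bipoly a0 a1 b0 b1 b2 m%:R n%:R) =
    (fun alpha => a0^-1 * g alpha * (h alpha)^-1).
  apply/funext => alpha; rewrite hE /net2 /bipoly /quad_coef /lin_coef /g /k.
  set m := (alpha ord0)%:R; set n := (alpha ord_max)%:R.
  have m_ge0 : 0 <= m by exact: ler0n.
  have n_ge0 : 0 <= n by exact: ler0n.
  clearbody m n.
  have A_gt0 : 0 < m + a1 by rewrite ltr_wpDl.
  have B_gt0 : 0 < b0 * (m + b1) * (m + b2) by rewrite !mulr_gt0// ltr_wpDl.
  by field; rewrite !gt_eqF// ltr_wpDl// !mulr_ge0// ltW.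
move=> l; apply: cm_upto_mul; last exact: cm_inv.
by apply: cm_upto_mul => //; apply: cm_upto_const; rewrite invr_ge0 ltW.
Qed.

End Bivariate.

Theorem theorem2p1 (R : realType) (a0 a1 b0 b1 b2 : R)
  (hb : b1 <= b2) (ha0 : a0 != 0) (ha1 : a1 != 0)
  (hp : forall x y : R, 0 <= x -> 0 <= y -> 0 < bipoly a0 a1 b0 b1 b2 x y) :
  joint_completely_monotone
    (net2 (fun m n : nat => 1 / bipoly a0 a1 b0 b1 b2 m%:R n%:R))
  <-> b1 <= a1 <= b2.
Proof.
have [a0_gt0 a1_gt0 b0_gt0 b1_gt0] := bipoly_pos_coefs hb ha0 ha1 hp.
have b2_gt0 : 0 < b2 := lt_le_trans b1_gt0 hb.
split=> [jcm|hab]; last exact/cm_joint/inv_bipoly_cm.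
pose d (m : nat) := (a0 * (m%:R + a1))^-1.
pose c (m : nat) := b0 * (m%:R + b1) * (m%:R + b2) * d m.
have d_gt0 m : 0 < d m by rewrite invr_gt0 mulr_gt0// ltr_wpDl.
have c_gt0 m : 0 < c m by rewrite !mulr_gt0// ltr_wpDl.
have netE : net2 (fun m n => 1 / bipoly a0 a1 b0 b1 b2 m%:R n%:R) =
            net2 (fun m n => d m * (c m + n%:R)^-1).
  apply/funext => alpha; rewrite /net2.
  set m := alpha ord0; set n := alpha ord_max.
  have : c m + n%:R != 0 by rewrite gt_eqF// ltr_wpDr.
  have -> : c m + n%:R = d m * bipoly a0 a1 b0 b1 b2 m%:R n%:R.
    rewrite /c /d /bipoly /quad_coef /lin_coef.
    by field; rewrite !gt_eqF// ltr_wpDl.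
  by rewrite mulf_eq0 negb_or invfM => /andP[dn _]; rewrite mulVKf ?div1r.
have := joint_cm_midpoint_concave d_gt0 c_gt0; rewrite -netE => /(_ jcm).
(* The second difference of [1 / (m + a1)] at [0] is
   [2 / (a1 (a1 + 1) (a1 + 2))]. *)
have -> : c 0%N + c 2%N = 2 * c 1%N +
    2 * b0 * ((b1 - a1) * (b2 - a1)) / (a0 * (a1 * (a1 + 1) * (a1 + 2))).
  rewrite /c /d; field.
  by rewrite !gt_eqF// ?addr_gt0.
rewrite gerDl pmulr_lle0 ?invr_gt0 ?mulr_gt0 ?addr_gt0// pmulr_rle0 ?mulr_gt0//.
move=> e_le0; apply/andP; split.
  rewrite leNgt; apply/negP => ab; move: e_le0; apply/negP.
  by rewrite -ltNge mulr_gt0// subr_gt0//; apply: lt_le_trans hb.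
rewrite leNgt; apply/negP => ba; move: e_le0; apply/negP.
by rewrite -ltNge nmulr_rgt0 ?subr_lt0//; apply: le_lt_trans ba.
Qed.
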